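(* Let $K$ be a commutative unital ring, $G$ a group, and $\alpha=(G,M,\{M_g\}_{g\in G},\{\alpha_g\}_{g\in G})$ a partial action of $G$ on a $K$-module $M$. Then the universal global action $\Theta$ of $G$ on $KG\otimes_{G_{par}}M$ (with the map $\iota:M\to KG\otimes_{G_{par}}M$, $\iota(m)=1\otimes_{G_{par}}m$) is a globalization of $\alpha$ if and only if for all $x,y\in M$ and $g\in G$ such that $g\otimes_{G_{par}}x=1\otimes_{G_{par}}y$, we have $x\in M_{g^{-1}}$ and $\alpha_g(x)=y$.
   Context: $K$ is a fixed commutative unital ring; $\otimes=\otimes_K$; $G$ is a group. A (left) partial action $\alpha=(G,M,\{M_g\},\{\alpha_g\})$ of $G$ on a $K$-module $M$ consists of $K$-submodules $M_g\subseteq M$ and $K$-linear isomorphisms $\alpha_g:M_{g^{-1}}\to M_g$ such that (i) $M_1=M$, $\alpha_1=\mathrm{id}_M$; (ii) $\alpha_g(M_{g^{-1}}\cap M_{g^{-1}h})\subseteq M_g\cap M_h$; (iii) $\alpha_g\alpha_h(x)=\alpha_{gh}(x)$ for $x\in M_{h^{-1}}\cap M_{h^{-1}g^{-1}}$. It is global if $M_g=M$ for all $g$. A $G$-equivariant map $\phi:M\to N$ between modules with partial actions $\alpha,\beta$ is a $K$-linear map with $\phi(M_g)\subseteq N_g$ and $\phi(\alpha_g(x))=\beta_g(\phi(x))$ for $x\in M_{g^{-1}}$. $KG\otimes_{G_{par}}M$ is the quotient of $KG\otimes M$ by the $K$-submodule generated by all $gh\otimes m-g\otimes\alpha_h(m)$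 with $g,h\in G$, $m\in M_{h^{-1}}$; $g\otimes_{G_{par}}m$ is the class of $g\otimes m$, and $\Theta_h(g\otimes_{G_{par}}m)=hg\otimes_{G_{par}}m$. A global action $\theta$ of $G$ on $W$ together with an injective $G$-equivariant map $j:M\to W$ is a globalization of $\alpha$ if $W=\sum_{g\in G}\theta_g(j(M))$ and $\alpha$ is isomorphic via $j$ to the restriction of $\theta$ to $j(M)$, i.e. $j(M_g)=\theta_g(j(M))\cap j(M)$ for all $g\in G$. *)

(* Defs.v *)
From HB Require Import structures.
From mathcomp Require Import all_boot all_algebra finmap.
From mathcomp Require Import boolp classical_sets functions cardinality fsbigop.

Set Implicit Arguments.
Unset Strict Implicit.
Unset Printing Implicit Defensive.

Import GRing.Theory.
Local Open Scope classical_set_scope.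
Local Open Scope ring_scope.

Section Span.
Variables (K : comPzRingType) (V : lmodType K).

Definition span (X : set V) : {pred V} :=
  fun v => `[< forall S : submodClosed V, X `<=` [set` S] -> v \in S >].

Lemma mem_span (X : set V) v : X v -> v \in span X.
Proof. by move=> Xv; apply/asboolP => S; apply. Qed.

Lemma span_submod_closed (X : set V) : subsemimod_closed (span X).
Proof.
split; first split=> [|u v /asboolP uX /asboolP vX]; try apply/asboolP => S XS.
- exact: rpred0.
- by rewrite rpredD ?uX ?vX.
- by move=> a u /asboolP uX; apply/asboolP => S XS; rewrite rpredZ ?uX.
Qed.

HB.instance Definition _ (X : set V) :=
  GRing.isSubmodClosed.Build K V (span X) (span_submod_closed X).

Definition full_pred : {pred V} := fun=> true.

Lemma full_submod_closed : subsemimod_closed full_pred.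
Proof. by []. Qed.

HB.instance Definition _ :=
  GRing.isSubmodClosed.Build K V full_pred full_submod_closed.

End Span.
Arguments full_pred {K} V.

Section QuotientModule.
Variables (K : comPzRingType) (V : lmodType K) (X : set V).
Local Open Scope quotient_scope.

Definition quotmod := Quotient.quot (span X).

HB.instance Definition _ := GRing.Zmodule.on quotmod.

Definition quot_pi (v : V) : quotmod := \pi v.

Lemma quot_piP u v : reflect (quot_pi u = quot_pi v) (u - v \in span X).
Proof. by rewrite Quotient.idealrBE; apply: eqP. Qed.

Lemma quot_pi_surj (q : quotmod) : exists v, q = quot_pi v.
Proof. by exists (repr q); rewrite /quot_pi reprK. Qed.

Lemma quot_piD u v : quot_pi (u + v) = quot_pi u + quot_pi v.
Proof. by rewrite /quot_pi !piE. Qed.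

Lemma quot_pi_repr u : repr (quot_pi u) - u \in span X.
Proof. by apply/quot_piP; rewrite /quot_pi reprK. Qed.

Definition quot_scale (a : K) (q : quotmod) : quotmod := quot_pi (a *: repr q).

Lemma quot_scaleE a v : quot_scale a (quot_pi v) = quot_pi (a *: v).
Proof. by apply/quot_piP; rewrite -scalerBr rpredZ// quot_pi_repr. Qed.

Lemma quot_scalerA a b q :
  quot_scale a (quot_scale b q) = quot_scale (a * b) q.
Proof. by case: (quot_pi_surj q) => v ->; rewrite !quot_scaleE scalerA. Qed.

Lemma quot_scale1r : left_id 1 quot_scale.
Proof.
by move=> q; case: (quot_pi_surj q) => v ->; rewrite quot_scaleE scale1r.
Qed.

Lemma quot_scalerDr : right_distributive quot_scale +%R.
Proof.
move=> a q r; case: (quot_pi_surj q) (quot_pi_surj r) => u -> [v ->].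
by rewrite -quot_piD !quot_scaleE -quot_piD scalerDr.
Qed.

Lemma quot_scalerDl q : {morph quot_scale^~ q : a b / a + b}.
Proof.
move=> a b; case: (quot_pi_surj q) => v ->.
by rewrite /= !quot_scaleE scalerDl quot_piD.
Qed.

HB.instance Definition _ := GRing.Zmodule_isLmodule.Build K quotmod
  quot_scalerA quot_scale1r quot_scalerDr quot_scalerDl.

Lemma quot_pi_linear : linear quot_pi.
Proof. by move=> a u v; rewrite quot_piD -quot_scaleE. Qed.

HB.instance Definition _ :=
  GRing.isLinear.Build K V quotmod *:%R quot_pi quot_pi_linear.

(* Meaningful when [f] vanishes on [X]. *)
Definition quot_lift (W : lmodType K) (f : {linear V -> W}) (q : quotmod) : W :=
  f (repr q).

Section Lift.
Variables (W : lmodType K) (f : {linear V -> W}).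
Hypothesis fX : forall x, X x -> f x = 0.

Lemma span_ker v : v \in span X -> f v = 0.
Proof.
pose ker_pred : {pred V} := fun u => f u == 0.
have kerP : subsemimod_closed ker_pred.
  split; first split=> [|x y /eqP fx /eqP fy]; try apply/eqP.
  - exact: linear0.
  - by rewrite linearD fx fy addr0.
  - by move=> a x /eqP fx; apply/eqP; rewrite linearZ /= fx scaler0.
pose kerM := GRing.isSubmodClosed.Build K V ker_pred kerP.
pose S : submodClosed V := HB.pack ker_pred kerM.
by move=> /asboolP/(_ S) vS; apply/eqP/vS => x /fX/eqP.
Qed.

Lemma quot_liftE v : quot_lift f (quot_pi v) = f v.
Proof.
by apply/eqP; rewrite -subr_eq0 -linearB span_ker// quot_pi_repr.
Qed.

Lemma quot_lift_linear : linear (quot_lift f).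
Proof.
move=> a q r; case: (quot_pi_surj q) (quot_pi_surj r) => u -> [v ->].
by rewrite -linearP !quot_liftE linearP.
Qed.

End Lift.
End QuotientModule.

Section FreeModule.
Variables (K : comPzRingType) (X : choiceType).

Definition finsupp_pred : {pred (X -> K^o)} :=
  fun f => `[< finite_set [set x | f x != 0] >].

Lemma finsupp_submod_closed : subsemimod_closed finsupp_pred.
Proof.
split; first split=> [|f g /asboolP ff /asboolP fg].
- by apply/asboolP; rewrite (_ : [set _ | _] = set0)// -subset0 => x /=; rewrite eqxx.
- apply/asboolP.
  apply: (@sub_finite_set _ _ ([set x | f x != 0] `|` [set x | g x != 0])).
    move=> x /= fgx; apply/orP; apply: contraNT fgx.
    by rewrite negb_or !negbK fctE => /andP[/eqP-> /eqP->]; rewrite addr0.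
  by rewrite finite_setU.
- move=> a f /asboolP ff; apply/asboolP.
  apply: sub_finite_set ff => x /=; apply: contraNN => /eqP fx.
  by rewrite fctE fx scaler0.
Qed.

HB.instance Definition _ :=
  GRing.isSubmodClosed.Build K (X -> K^o) finsupp_pred finsupp_submod_closed.

Record freemod := FreeMod {
  freemod_val : X -> K^o;
  _ : freemod_val \in finsupp_pred
}.

HB.instance Definition _ := [isSub for freemod_val].
HB.instance Definition _ := [Choice of freemod by <:].
HB.instance Definition _ := [SubChoice_isSubLmodule of freemod by <:].

Definition coef (f : freemod) (x : X) : K := freemod_val f x.
Coercion coef : freemod >-> Funclass.

Lemma freemodP (f g : freemod) : (forall x, f x = g x) -> f = g.
Proof. by move=> fg; apply/val_inj/funext. Qed.

Lemma coefD (f g : freemod) x : (f + g) x = f x + g x.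
Proof. by rewrite /coef -[freemod_val _]/(val (f + g)) raddfD. Qed.

Lemma coefZ a (f : freemod) x : (a *: f) x = a * f x.
Proof. by rewrite /coef -[freemod_val _]/(val (a *: f)) linearZ. Qed.

Lemma coef_sum (I : Type) (r : seq I) (F : I -> freemod) x :
  (\sum_(i <- r) F i) x = \sum_(i <- r) F i x.
Proof.
by rewrite /coef -[freemod_val _]/(val (\sum_(i <- r) F i)) raddf_sum fct_sumE.
Qed.

Lemma coef_finite (f : freemod) : finite_set [set x | f x != 0].
Proof. by case: f => f fP; move/asboolP: (fP). Qed.

Lemma delta_subproof x : (fun y => (y == x)%:R : K^o) \in finsupp_pred.
Proof.
apply/asboolP; apply: (@sub_finite_set _ _ [set x]) => // y /=.
by case: (y =P x) => // _ /eqP.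
Qed.

Definition delta x : freemod := FreeMod (delta_subproof x).

Lemma coef_delta x y : delta x y = (y == x)%:R.
Proof. by []. Qed.

Section Lift.
Variables (W : lmodType K) (phi : X -> W).

Definition free_lift (f : freemod) : W := \sum_(x \in [set: X]) f x *: phi x.

Lemma free_liftE (f : freemod) (A : set X) (finA : finite_set A) :
  (forall x, f x != 0 -> A x) ->
  free_lift f = \sum_(x <- fset_set A) f x *: phi x.
Proof.
move=> fA; apply: fsbigTE => x; apply: contraNeq => fx.
rewrite in_fset_set// inE; apply: fA; apply: contraNneq fx => ->.
by rewrite scale0r.
Qed.

Lemma free_lift_linear : linear free_lift.
Proof.
move=> a f g.
pose A := [set x | f x != 0] `|` [set x | g x != 0].
have finA : finite_set A by rewrite finite_setU; split; apply: coef_finite.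
rewrite (free_liftE (f := f) finA); last by move=> x fx; left.
rewrite (free_liftE (f := g) finA); last by move=> x gx; right.
rewrite (free_liftE finA); last first.
  move=> x fgx; apply/orP; apply: contraNT fgx.
  rewrite negb_or !negbK coefD coefZ => /andP[/eqP-> /eqP->].
  by rewrite mulr0 addr0.
rewrite scaler_sumr -big_split; apply: eq_bigr => x _.
by rewrite coefD coefZ scalerDl scalerA.
Qed.

HB.instance Definition _ :=
  GRing.isLinear.Build K freemod W *:%R free_lift free_lift_linear.

Lemma free_lift_delta x : free_lift (delta x) = phi x.
Proof.
rewrite (free_liftE (finite_set1 x)); last first.
  by move=> y; rewrite coef_delta; case: (y =P x) => // _ /eqP.
by rewrite fset_set1 big_seq_fset1 coef_delta eqxx scale1r.
Qed.

End Lift.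

Lemma freemodE (f : freemod) :
  f = \sum_(x <- fset_set [set x | f x != 0]) f x *: delta x.
Proof.
apply: freemodP => y; rewrite coef_sum.
under eq_bigr do rewrite coefZ coef_delta.
have finf := coef_finite f.
have [fy0|fy] := eqVneq (f y) 0.
  rewrite big1_seq// => x /andP[_]; rewrite in_fset_set// inE => /= fx.
  by case: eqP => [yx|_]; rewrite ?mulr0// -yx fy0 mul0r.
rewrite (big_rem y) /=; last by rewrite in_fset_set// inE.
rewrite eqxx mulr1 big1_seq ?addr0// => x /andP[_].
rewrite mem_rem_uniq ?fset_uniq// inE => /andP[xy _].
by rewrite eq_sym (negPf xy) mulr0.
Qed.

Lemma eq_free_linear (W : lmodType K) (u v : {linear freemod -> W}) :
  (forall x, u (delta x) = v (delta x)) -> u =1 v.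
Proof.
move=> uv f; rewrite (freemodE f) !linear_sum.
by apply: eq_bigr => x _; rewrite !linearZ uv.
Qed.

End FreeModule.
Arguments delta K {X} x.

Section TensorProduct.
Variables (K : comPzRingType) (A B : lmodType K).

Definition bilin_rel : set (freemod K (A * B)%type) :=
  [set z | exists (a a' : A) (b : B),
     z = delta K (a + a', b) - (delta K (a, b) + delta K (a', b))] `|`
  [set z | exists (a : A) (b b' : B),
     z = delta K (a, b + b') - (delta K (a, b) + delta K (a, b'))] `|`
  [set z | exists (k : K) (a : A) (b : B), z = delta K (k *: a, b) - k *: delta K (a, b)] `|`
  [set z | exists (k : K) (a : A) (b : B), z = delta K (a, k *: b) - k *: delta K (a, b)].

Definition tensor := quotmod bilin_rel.
HB.instance Definition _ := GRing.Lmodule.on tensor.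

Definition tens (a : A) (b : B) : tensor := quot_pi bilin_rel (delta K (a, b)).

Lemma tensPl k a a' b : tens (k *: a + a') b = k *: tens a b + tens a' b.
Proof.
transitivity (tens (k *: a) b + tens a' b).
  rewrite /tens -linearD; apply/quot_piP/mem_span; left; left; left.
  by exists (k *: a), a', b.
congr (_ + _); rewrite /tens -linearZ; apply/quot_piP/mem_span; left; right.
by exists k, a, b.
Qed.

Lemma tensPr k a b b' : tens a (k *: b + b') = k *: tens a b + tens a b'.
Proof.
transitivity (tens a (k *: b) + tens a b').
  rewrite /tens -linearD; apply/quot_piP/mem_span; left; left; right.
  by exists a, (k *: b), b'.
congr (_ + _); rewrite /tens -linearZ; apply/quot_piP/mem_span; right.
by exists k, a, b.
Qed.

(* Meaningful when [phi] is bilinear. *)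
Definition tens_lift (W : lmodType K) (phi : A -> B -> W) : tensor -> W :=
  @quot_lift _ _ bilin_rel W (free_lift (fun p : A * B => phi p.1 p.2)).

Section Lift.
Variables (W : lmodType K) (phi : A -> B -> W).
Hypothesis phil : forall b, linear (phi^~ b).
Hypothesis phir : forall a, linear (phi a).

Lemma bilin_rel_ker z :
  bilin_rel z -> free_lift (fun p : A * B => phi p.1 p.2) z = 0.
Proof.
have phi0l b : phi 0 b = 0.
  by have := phil b (-1) 0 0; rewrite scaler0 addr0 scaleN1r addNr.
have phi0r a : phi a 0 = 0.
  by have := phir a (-1) 0 0; rewrite scaler0 addr0 scaleN1r addNr.
case=> [[[]|]|]; [move=> [a [a' [b ->]]] | move=> [a [b [b' ->]]]
  | move=> [k [a [b ->]]] | move=> [k [a [b ->]]]];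
  apply/eqP; rewrite linearB subr_eq0; apply/eqP;
  rewrite ?linearD ?linearZ /= !free_lift_delta /=.
- by have := phil b 1 a a'; rewrite /= !scale1r.
- by have := phir a 1 b b'; rewrite !scale1r.
- by have := phil b k a 0; rewrite addr0 /= phi0l addr0.
- by have := phir a k b 0; rewrite addr0 phi0r addr0.
Qed.

Lemma tens_liftE a b : tens_lift phi (tens a b) = phi a b.
Proof.
rewrite /tens_lift quot_liftE; first by rewrite /= free_lift_delta.
exact: bilin_rel_ker.
Qed.

Lemma tens_lift_linear : linear (tens_lift phi).
Proof. by apply: quot_lift_linear; apply: bilin_rel_ker. Qed.

End Lift.

Lemma eq_tens_linear (W : lmodType K) (u v : {linear tensor -> W}) :
  (forall a b, u (tens a b) = v (tens a b)) -> u =1 v.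
Proof.
move=> uv q; have [z ->] := quot_pi_surj q.
apply: (@eq_free_linear _ _ _ (u \o quot_pi bilin_rel)
  (v \o quot_pi bilin_rel)) => -[a b]; exact: uv.
Qed.

End TensorProduct.

Section TensorMap.
Variables (K : comPzRingType) (A A' B : lmodType K) (f : {linear A -> A'}).

Definition tens_mapl : tensor A B -> tensor A' B :=
  tens_lift (fun a b => tens (f a) b).

Lemma tens_mapl_subl (b : B) : linear (fun a => tens (f a) b).
Proof. by move=> k a a'; rewrite linearP tensPl. Qed.

Lemma tens_mapl_subr a : linear (tens (B := B) (f a)).
Proof. by move=> k b b'; rewrite tensPr. Qed.

Lemma tens_maplE a b : tens_mapl (tens a b) = tens (f a) b.
Proof. exact: (tens_liftE tens_mapl_subl tens_mapl_subr). Qed.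

Lemma tens_mapl_linear : linear tens_mapl.
Proof. exact: (tens_lift_linear tens_mapl_subl tens_mapl_subr). Qed.

HB.instance Definition _ := GRing.isLinear.Build K (tensor A B) (tensor A' B)
  *:%R tens_mapl tens_mapl_linear.

End TensorMap.

(* [pact g] is total for convenience; only its restriction to the submodule
   [pdom g^-1] is meaningful, and that restriction is required to be a
   [K]-linear bijection onto [pdom g]. *)
Record partial_action (K : comPzRingType) (G : groupType) (M : lmodType K) :=
  PartialAction {
  pdom : G -> submodClosed M;
  pact : G -> M -> M;
  pact_linear : forall g a, {in pdom g^-1%g &, forall x y,
    pact g (a *: x + y) = a *: pact g x + pact g y};
  pact_bij : forall g, set_bij [set` pdom g^-1%g] [set` pdom g] (pact g);
  pdom1 : forall x, x \in pdom 1%g;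
  pact1 : forall x, pact 1%g x = x;
  pact_dom : forall g h x, x \in pdom g^-1%g -> x \in pdom (g^-1 * h)%g ->
    pact g x \in pdom g /\ pact g x \in pdom h;
  pactM : forall g h x, x \in pdom h^-1%g -> x \in pdom (h^-1 * g^-1)%g ->
    pact g (pact h x) = pact (g * h)%g x
}.

Section PartialActions.
Variables (K : comPzRingType) (G : groupType).

Definition is_global (M : lmodType K) (alpha : partial_action G M) : Prop :=
  forall g x, x \in pdom alpha g.

Definition equivariant (M N : lmodType K) (alpha : partial_action G M)
    (beta : partial_action G N) (phi : {linear M -> N}) : Prop :=
  (forall g x, x \in pdom alpha g -> phi x \in pdom beta g) /\
  (forall g x, x \in pdom alpha g^-1%g ->
     phi (pact alpha g x) = pact beta g (phi x)).

(* The last two clauses: [W] is the sum of the submodules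
   [theta_g (j M)], and the image of [alpha] under [j] has the domains of the
   restriction of [theta] to [j M]; that [j] carries [pact alpha] to
   [pact theta] is part of [equivariant]. *)
Definition is_globalization (M W : lmodType K) (alpha : partial_action G M)
    (theta : partial_action G W) (j : {linear M -> W}) : Prop :=
  [/\ is_global theta,
      injective j,
      equivariant alpha theta j,
      (forall w, exists s : seq (G * M),
         w = \sum_(p <- s) pact theta p.1 (j p.2)) &
      forall g, j @` [set` pdom alpha g] =
                (pact theta g @` (range j)) `&` range j].

End PartialActions.

Section UniversalGlobalAction.
Variables (K : comPzRingType) (G : groupType).

(* The [K]-module underlying the group algebra of [G], with basis
   [delta K g]; the multiplication of the algebra enters only through
   left multiplication by group elements. *)
Definition group_alg := freemod K G.
HB.instance Definition _ := GRing.Lmodule.on group_alg.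

Definition left_mul (h : G) : {linear group_alg -> group_alg} :=
  free_lift (fun g : G => delta K (h * g)%g).

Variables (M : lmodType K) (alpha : partial_action G M).

Definition gpar_rel : set (tensor group_alg M) :=
  [set z | exists g h m, m \in pdom alpha h^-1%g /\
     z = tens (delta K (g * h)%g : group_alg) m -
         tens (delta K g : group_alg) (pact alpha h m)].

Definition gpar := quotmod gpar_rel.
HB.instance Definition _ := GRing.Lmodule.on gpar.

Definition gpar_tens (g : G) (m : M) : gpar :=
  quot_pi gpar_rel (tens (delta K g : group_alg) m).

Lemma gpar_tens_linear g : linear (gpar_tens g).
Proof. by move=> a x y; rewrite /gpar_tens tensPr linearP. Qed.

HB.instance Definition _ g :=
  GRing.isLinear.Build K M gpar *:%R (gpar_tens g) (gpar_tens_linear g).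

Definition gpar_iota : {linear M -> gpar} := gpar_tens 1%g.

Definition Theta_fun (h : G) : gpar -> gpar :=
  @quot_lift _ _ gpar_rel gpar
    (quot_pi gpar_rel \o @tens_mapl _ _ _ M (left_mul h)).

Lemma Theta_ker h z :
  gpar_rel z -> (quot_pi gpar_rel \o @tens_mapl _ _ _ M (left_mul h)) z = 0.
Proof.
move=> [g [k [m [mk ->]]]] /=.
rewrite !linearB /= !tens_maplE /= !free_lift_delta -linearB /=.
rewrite -[RHS](linear0 (quot_pi gpar_rel)); apply/quot_piP; rewrite subr0.
by apply: mem_span; exists (h * g)%g, k, m; rewrite mulgA.
Qed.

Lemma Theta_linear h : linear (Theta_fun h).
Proof. by apply: quot_lift_linear; apply: Theta_ker. Qed.

HB.instance Definition _ h :=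
  GRing.isLinear.Build K gpar gpar *:%R (Theta_fun h) (Theta_linear h).

Lemma Theta_tens h g m :
  Theta_fun h (gpar_tens g m) = gpar_tens (h * g)%g m.
Proof.
rewrite /Theta_fun quot_liftE; last exact: Theta_ker.
by rewrite /= tens_maplE /= free_lift_delta.
Qed.

Lemma eq_gpar_linear (W : lmodType K) (u v : {linear gpar -> W}) :
  (forall g m, u (gpar_tens g m) = v (gpar_tens g m)) -> u =1 v.
Proof.
move=> uv q; have [z ->] := quot_pi_surj q.
apply: (@eq_tens_linear _ _ _ _ (u \o quot_pi gpar_rel)
  (v \o quot_pi gpar_rel)) => f m /=.
have tl : linear (fun f : group_alg => quot_pi gpar_rel (tens f m)).
  by move=> a f1 f2; rewrite tensPl linearP.
pose tlm := GRing.isLinear.Build _ _ _ _ _ tl.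
pose t : {linear group_alg -> gpar} :=
  HB.pack (fun f : group_alg => quot_pi gpar_rel (tens f m)) tlm.
by apply: (@eq_free_linear _ _ _ (u \o t) (v \o t)) => g; apply: uv.
Qed.

Lemma Theta1 q : Theta_fun 1%g q = q.
Proof.
apply: (@eq_gpar_linear _ (Theta_fun 1%g) idfun) => g m.
by rewrite /= Theta_tens mul1g.
Qed.

Lemma ThetaM g h q : Theta_fun g (Theta_fun h q) = Theta_fun (g * h)%g q.
Proof.
apply: (@eq_gpar_linear _ (Theta_fun g \o Theta_fun h)
  (Theta_fun (g * h)%g)) => k m /=.
by rewrite !Theta_tens mulgA.
Qed.

Lemma Theta_bij g :
  set_bij [set` full_pred gpar] [set` full_pred gpar] (Theta_fun g).
Proof.
split=> // [p q _ _ pq|q _].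
  by rewrite -[p]Theta1 -[q]Theta1 -(mulVg g) -!ThetaM pq.
by exists (Theta_fun g^-1%g q) => //; rewrite ThetaM mulgV Theta1.
Qed.

Definition Theta : partial_action G gpar :=
  @PartialAction K G gpar (fun=> full_pred gpar) Theta_fun
    (fun g a x y _ _ => Theta_linear g a x y) Theta_bij
    (fun=> isT) Theta1 (fun _ _ _ _ _ => conj isT isT)
    (fun g h x _ _ => ThetaM g h x).

End UniversalGlobalAction.

(* Main.v *)
Require Import Defs.
From HB Require Import structures.
From mathcomp Require Import all_boot all_algebra.
From mathcomp Require Import boolp classical_sets.

(** By construction [Theta] is global, [iota] is equivariant and the translates
    of [iota M] add up to the whole tensor product, whatever [alpha] is.  The
    content of being a globalization thus lies in the injectivity of [iota] and
    in the equality of [iota (M_g)] with the trace of [Theta_g (iota M)] on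
    [iota M].  Since the class of [g ⊗ x] is [Theta_g (iota x)], the
    condition of the theorem speaks of exactly the coincidences
    [Theta_g (iota x) = iota y], which are the points of that trace.

    If [Theta] is a globalization, such a point comes from some [y = alpha_g z]
    with [z] in the domain of [alpha_g]; equivariance gives
    [Theta_g (iota z) = Theta_g (iota x)], hence [z = x].  Conversely, the
    condition at [g = 1] is injectivity of [iota], and at an arbitrary [g] it is
    the nontrivial inclusion between the two sets
    ([restriction_of_tensor_condition]).  The generation of the tensor product
    by translates of [iota M] is [gpar_sum_translates]. *)

Set Implicit Arguments.
Unset Strict Implicit.
Unset Printing Implicit Defensive.

Import GRing.Theory.
Local Open Scope classical_set_scope.
Local Open Scope ring_scope.

Section UniversalGlobalActionTheory.
Variables (K : comPzRingType) (G : groupType) (M : lmodType K).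
Variable alpha : partial_action G M.

Lemma Theta_iota g x :
  Theta_fun g (gpar_iota alpha x) = gpar_tens alpha g x.
Proof. by rewrite /gpar_iota Theta_tens mulg1. Qed.

Lemma Theta_inj g : injective (@Theta_fun _ _ _ alpha g).
Proof. by case: (Theta_bij alpha g) => _ inj _ p q; apply: inj; rewrite inE. Qed.

Lemma pact_in_pdom g x : x \in pdom alpha g^-1%g -> pact alpha g x \in pdom alpha g.
Proof. by case: (pact_bij alpha g) => im _ _; apply: im. Qed.

Lemma gpar_tens_pact g x : x \in pdom alpha g^-1%g ->
  gpar_tens alpha 1%g (pact alpha g x) = gpar_tens alpha g x.
Proof.
move=> xg; apply/esym/quot_piP/mem_span.
by exists 1%g, g, x; rewrite mul1g.
Qed.

Lemma iota_equivariant : equivariant alpha (Theta alpha) (gpar_iota alpha).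
Proof. by split=> // g x xg; rewrite [RHS]Theta_iota -gpar_tens_pact. Qed.

(** The finite sums of classes [g ⊗ m] form a submodule, because a scalar can be
    absorbed into [m]; the projection modulo this submodule agrees with the zero
    map on all [g ⊗ m], so the submodule is everything. *)
Lemma gpar_sum_tens (w : gpar alpha) :
  exists s : seq (G * M), w = \sum_(p <- s) gpar_tens alpha p.1 p.2.
Proof.
pose X : set (gpar alpha) :=
  [set v | exists s : seq (G * M), v = \sum_(p <- s) gpar_tens alpha p.1 p.2].
pose sums : {pred gpar alpha} := fun v => `[< X v >].
have sumsP : subsemimod_closed sums.
  split; first split=> [|u v /asboolP[s ->] /asboolP[t ->]].
  - by apply/asboolP; exists [::]; rewrite big_nil.
  - by apply/asboolP; exists (s ++ t); rewrite big_cat.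
  - move=> a u /asboolP[s ->]; apply/asboolP.
    exists [seq (p.1, a *: p.2) | p <- s].
    rewrite big_map scaler_sumr; apply: eq_bigr => p _ /=.
    by rewrite linearZ.
pose sumsM := GRing.isSubmodClosed.Build K (gpar alpha) sums sumsP.
pose S : submodClosed (gpar alpha) := HB.pack sums sumsM.
have pi0 : quot_pi X =1 (\0 : {linear gpar alpha -> quotmod X}).
  apply: eq_gpar_linear => g m /=.
  rewrite -(linear0 (quot_pi X)); apply/quot_piP; rewrite subr0.
  by apply: mem_span; exists [:: (g, m)]; rewrite big_seq1.
have /quot_piP : quot_pi X w = quot_pi X 0 by rewrite linear0 pi0.
by rewrite subr0 => /asboolP/(_ S) wS; apply/asboolP/wS => v /asboolP.
Qed.

Lemma gpar_sum_translates (w : gpar alpha) :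
  exists s : seq (G * M),
    w = \sum_(p <- s) pact (Theta alpha) p.1 (gpar_iota alpha p.2).
Proof.
have [s ->] := gpar_sum_tens w; exists s.
by apply: eq_bigr => p _; rewrite /= Theta_iota.
Qed.

Definition tensor_condition : Prop := forall (x y : M) (g : G),
  gpar_tens alpha g x = gpar_tens alpha 1%g y ->
  x \in pdom alpha g^-1%g /\ pact alpha g x = y.

Lemma iota_inj_of_tensor_condition :
  tensor_condition -> injective (gpar_iota alpha).
Proof. by move=> cond x y /cond[_]; rewrite pact1. Qed.

(** Every [y] in [M_g] is [alpha_g x] for some [x], so that [iota y] is the
    translate [Theta_g (iota x)]; the condition provides the converse. *)
Lemma restriction_of_tensor_condition : tensor_condition -> forall g,
  gpar_iota alpha @` [set` pdom alpha g] =
  (pact (Theta alpha) g @` range (gpar_iota alpha)) `&` range (gpar_iota alpha).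
Proof.
move=> cond g; apply/seteqP; split=> w.
- case=> y yg <-; split; last by exists y.
  have [_ _ /(_ y yg)[x xg <-]] := pact_bij alpha g.
  exists (gpar_iota alpha x); first by exists x.
  by rewrite [LHS]Theta_iota [RHS]gpar_tens_pact.
- case=> -[_ [x _ <-] <-] [y _]; rewrite [pact _ _ _]Theta_iota => xy.
  have [xg xy'] := cond _ _ _ (esym xy).
  by exists y => //=; rewrite -xy'; apply: pact_in_pdom.
Qed.

Lemma tensor_condition_of_globalization :
  is_globalization alpha (Theta alpha) (gpar_iota alpha) -> tensor_condition.
Proof.
case=> _ iota_inj _ _ restr x y g gxy.
have : (gpar_iota alpha @` [set` pdom alpha g]) (gpar_iota alpha y).
  rewrite restr; split; last by exists y.
  exists (gpar_iota alpha x); first by exists x.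
  by rewrite [LHS]Theta_iota.
case=> y' y'g /iota_inj yy'; rewrite {}yy' in y'g.
have [_ _ /(_ y y'g)[z zg zy]] := pact_bij alpha g.
suff -> : x = z by [].
apply/iota_inj/(@Theta_inj g).
by rewrite !Theta_iota gxy -zy gpar_tens_pact.
Qed.

End UniversalGlobalActionTheory.

Theorem proposition2p31 (K : comPzRingType) (G : groupType) (M : lmodType K)
    (alpha : partial_action G M) :
  is_globalization alpha (Theta alpha) (gpar_iota alpha) <->
  (forall (x y : M) (g : G),
     gpar_tens alpha g x = gpar_tens alpha 1%g y ->
     x \in pdom alpha g^-1%g /\ pact alpha g x = y).
Proof.
split; first exact: tensor_condition_of_globalization.
move=> cond; split.
- by [].
- exact: iota_inj_of_tensor_condition.
- exact: iota_equivariant.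
- exact: gpar_sum_translates.
- exact: restriction_of_tensor_condition.
Qed.
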